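(* The sequences of Bernoulli numbers $\{B_l^\pm\}_{l\ge0}$ can be equivalently defined in the following recursive way. Set $B_0^\pm=1$. Then choose $B_1^+$ and $B_1^-$ by minimising respectively the quadratic functions $$v\in\mathbb{R}\mapsto\int_0^N|t-[t]-v|^2\,\mathrm{d}t,\qquad v\in\mathbb{R}\mapsto\int_0^N|t-[t+1]-v|^2\,\mathrm{d}t.$$ Then, for any integer $l\ge2$, the term $B_l^\pm$ is obtained by minimising the quadratic function $$v\in\mathbb{R}\mapsto\int_0^N\big|s^{\pm,l}_{B^{\pm,<l}}(t)+v\big|^2\,\mathrm{d}t,$$ where $B^{\pm,<l}=(B_0^\pm,-B_1^\pm,B_2^\pm,\ldots,B_{l-1}^\pm,0,0,\ldots)$.
   Context: $N\ge1$ is an integer and $[t]$ is the integer part of $t$. The Bernoulli numbers are $B_0^\pm=1$, $B_1^\pm=\pm\frac12$, $B_2^\pm=\frac16$, $B_4^\pm=-\frac1{30}$, $B_6^\pm=\frac1{42},\ldots$, and $B_3^\pm=B_5^\pm=B_7^\pm=\cdots=0$. For any sequence of numbers $b=(b_0,b_1,\ldots)$, the sequences of sawtooth functions $s_b^\pm=(s_b^{\pm,0},s_b^{\pm,1},\ldots)$ are defined by $s_b^{\pm,0}$ constant and equal to $1$ and, for any integer $l\ge1$, $$s_b^{+,l}(t)=\sum_{j=0}^l\frac{t^{l-j}}{(l-j)!}b_j-\sum_{k=0}^{[t]-1}\frac{(t-k-1)^{l-1}}{(l-1)!},$$ $$s_b^{-,l}(t)=\sum_{j=0}^l\frac{t^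{l-j}}{(l-j)!}b_j-\sum_{k=0}^{[t]}\frac{(t-k)^{l-1}}{(l-1)!}.$$
   Formalization: With the sawtooth functions as displayed, the recursion produces B_l^±/l! and not B_l^± (for l = 2 the minimiser is 1/12, not B_2 = 1/6); the formal theorem keeps the recursion as displayed and identifies its terms with B_l^±/l!. *)

(* Defs.v *)
From Stdlib Require Import Reals ZArith Arith List Lra Lia.
From Coquelicot Require Import Coquelicot.
Open Scope R_scope.

Inductive pm : Set := Plus | Minus.

(* [bernoulli_upto n j] is B_j^- for j <= n, computed from the recurrence
   sum_{j=0}^{m} C(m+1,j) B_j^- = 0  (m >= 1),  B_0^- = 1. *)
Fixpoint bernoulli_upto (n : nat) : nat -> R :=
  match n with
  | O => fun _ => 1
  | S m => fun j =>
      if (j <=? m)%nat then bernoulli_upto m j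
      else - / INR (m + 2) *
             sum_f_R0 (fun i => Binomial.C (m + 2) i * bernoulli_upto m i) m
  end.

(* The two conventions differ only at index 1: B_1^+ = 1/2, B_1^- = -1/2. *)
Definition bernoulli (e : pm) (l : nat) : R :=
  match e, l with
  | Plus, 1%nat => 1 / 2
  | _, _ => bernoulli_upto l l
  end.

(* f 0 + ... + f (n-1), empty when n = 0; Stdlib's [sum_f_R0 f n] has n+1 terms. *)
Definition sum_below (f : nat -> R) (n : nat) : R :=
  fold_right Rplus 0 (map f (seq 0 n)).

(* Sums over 0 <= k <= [t]-1 and 0 <= k <= [t] are empty when the upper bound
   is negative, which [Z.to_nat] implements. *)
Definition sawtooth (e : pm) (b : nat -> R) (l : nat) (t : R) : R :=
  match l with
  | O => 1
  | S p =>
      sum_f_R0 (fun j => t ^ (l - j) / INR (fact (l - j)) * b j) l -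
      match e with
      | Plus =>
          sum_below (fun k => (t - INR k - 1) ^ p / INR (fact p))
                    (Z.to_nat (Int_part t))
      | Minus =>
          sum_below (fun k => (t - INR k) ^ p / INR (fact p))
                    (Z.to_nat (Int_part t + 1))
      end
  end.

Definition integer_part_of (e : pm) (t : R) : R :=
  match e with
  | Plus => IZR (Int_part t)
  | Minus => IZR (Int_part (t + 1))
  end.

(* (b_0, -b_1, b_2, ..., b_{l-1}, 0, 0, ...). *)
Definition below (b : nat -> R) (l j : nat) : R :=
  if (j <? l)%nat then (if (j =? 1)%nat then - b j else b j) else 0.

(* The sawtooth functions carry no factorial with b_j, so the Bernoulli numbers
   enter them divided by l!: s_b^{e,l} is the periodic Bernoulli function
   B_l(t-[t])/l! for b = (1, -B_1/1!, B_2/2!, B_3/3!, ...). *)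
Definition normalised_bernoulli (e : pm) (l : nat) : R :=
  bernoulli e l / INR (fact l).

Definition is_minimiser (f : R -> R) (v : R) : Prop := forall w, f v <= f w.

(* Main.v *)
(** For [c j = B_j^- / j!], the polynomials [P_l(x) = sum_j c_j x^(l-j) / (l-j)!]
    satisfy [P_(l+1)' = P_l] and, by the recurrence for the Bernoulli numbers,
    [P_l(1) = P_l(0)] for [l >= 2].  Hence [P_l] has mean zero on [[0,1]] for
    [l >= 1], and [P_l(x+1) - P_l(x) = x^(l-1) / (l-1)!].  Telescoping the latter,
    the sawtooth function built from [c_0, ..., c_(l-1)] is the 1-periodic function
    [P_l(t - [t]) - c_l].  The quadratic functions being minimised are
    [N * ((v - m)^2 + d)] with [m] the relevant mean over one period, which
    determines [b_l] uniquely from its predecessors. *)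
Require Import Defs.
From Stdlib Require Import Reals ZArith Arith List Lra Lia.
From Coquelicot Require Import Coquelicot.
Open Scope R_scope.

(** * Quadratic functions and mean values of periodic functions *)

Lemma unique_minimiser_ext (Q Q' : R -> R) (x : R) :
  (forall v, Q v = Q' v) ->
  unique (is_minimiser Q) x <-> unique (is_minimiser Q') x.
Proof.
intros HQ.
assert (H : forall y, is_minimiser Q y <-> is_minimiser Q' y).
{ intros y. split; intros Hy w; specialize (Hy w);
    [rewrite <- !HQ | rewrite !HQ]; exact Hy. }
split; intros [Hx Huniq]; (split; [now apply H | intros y Hy; now apply Huniq, H]).
Qed.

Lemma unique_minimiser_quadratic (Q : R -> R) (k m d x : R) :
  0 < k -> (forall v, Q v = k * ((v - m) ^ 2 + d)) ->
  unique (is_minimiser Q) x <-> x = m.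
Proof.
intros Hk HQ.
assert (Hmin : forall y, is_minimiser Q y -> y = m).
{ intros y Hy. specialize (Hy m). rewrite !HQ in Hy.
  assert (H : (y - m) ^ 2 <= 0).
  { apply Rmult_le_reg_l in Hy; [|exact Hk]. rewrite Rminus_diag in Hy. lra. }
  destruct (Req_dec (y - m) 0) as [H0|H0]; [lra|].
  apply pow2_gt_0 in H0. lra. }
assert (Hm : is_minimiser Q m).
{ intros w. rewrite !HQ, Rminus_diag.
  apply Rmult_le_compat_l; [lra|]. assert (H := pow2_ge_0 (w - m)). lra. }
split.
- intros [Hx _]. now apply Hmin.
- intros ->. split; [exact Hm|]. intros y Hy. symmetry. now apply Hmin.
Qed.

(** Chasles' relation and translation reduce each unit interval to $[0,1]$. Only open intervals are
    constrained because the integer part jumps at the integers, and endpoints do not affect the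
    integral. *)
Lemma is_RInt_periodic_pieces (f g : R -> R) (I : R) (N : nat) :
  (forall n t, INR n < t < INR n + 1 -> f t = g (t - INR n)) ->
  is_RInt g 0 1 I -> is_RInt f 0 (INR N) (INR N * I).
Proof.
intros Hfg Hg. induction N as [|N IH].
- simpl INR. rewrite Rmult_0_l. apply (@is_RInt_point R_NormedModule).
- rewrite S_INR.
  replace ((INR N + 1) * I) with (plus (INR N * I) I)
    by (unfold plus; simpl; ring).
  apply (@is_RInt_Chasles R_NormedModule) with (INR N); [exact IH|].
  apply (@is_RInt_ext R_NormedModule) with (fun t => scal 1 (g (1 * t + - INR N))).
  + intros t. rewrite Rmin_left, Rmax_right by lra. intros Ht.
    rewrite (Hfg N t Ht). unfold scal; simpl; unfold mult; simpl.
    rewrite Rmult_1_l. f_equal. ring.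
  + apply (@is_RInt_comp_lin R_NormedModule).
    replace (1 * INR N + - INR N) with 0 by ring.
    replace (1 * (INR N + 1) + - INR N) with 1 by ring.
    exact Hg.
Qed.

(** With $A=\int_0^1 g^2$, expanding the square gives $\int_0^1(g-v)^2=A-2vm+v^2=(v-m)^2+(A-m^2)$,
    and $N$ periods multiply this by $N>0$. Continuity of [g] makes $g^2$ integrable. *)
Lemma unique_minimiser_mean (f g : R -> R) (m : R) (N : nat) (x : R) :
  (1 <= N)%nat ->
  (forall n t, INR n < t < INR n + 1 -> f t = g (t - INR n)) ->
  (forall t, continuous g t) -> is_RInt g 0 1 m ->
  unique (is_minimiser (fun v => RInt (fun t => Rabs (f t - v) ^ 2) 0 (INR N))) x
  <-> x = m.
Proof.
intros HN Hfg Hc Hg.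
assert (Hsq : ex_RInt (fun t => g t * g t) 0 1).
{ apply (@ex_RInt_continuous R_CompleteNormedModule). intros t _.
  now apply (@continuous_mult R_UniformSpace R_AbsRing). }
destruct Hsq as [A HA].
apply unique_minimiser_quadratic with (k := INR N) (d := A - m ^ 2).
- apply lt_0_INR. lia.
- intros v. apply is_RInt_unique.
  apply is_RInt_periodic_pieces with (fun t => (g t - v) ^ 2).
  + intros n t Ht. rewrite pow2_abs. now rewrite (Hfg n t Ht).
  + replace ((v - m) ^ 2 + (A - m ^ 2))
      with (plus (plus A (scal (- 2 * v) m)) (scal (1 - 0) (v ^ 2)))
      by (unfold plus, scal; simpl; unfold mult; simpl; ring).
    apply (@is_RInt_ext R_NormedModule)
      with (fun t => plus (plus (g t * g t) (scal (- 2 * v) (g t))) (v ^ 2)).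
    * intros t _. unfold plus, scal; simpl; unfold mult; simpl. ring.
    * apply (@is_RInt_plus R_NormedModule); [apply (@is_RInt_plus R_NormedModule)|].
      -- exact HA.
      -- now apply (@is_RInt_scal R_NormedModule).
      -- apply (@is_RInt_const R_NormedModule).
Qed.

(** * The recurrence for the Bernoulli numbers divided by factorials *)

Lemma bernoulli_upto_diag (n j : nat) :
  (j <= n)%nat -> bernoulli_upto n j = bernoulli_upto j j.
Proof.
induction n as [|n IH]; intros Hj.
- now replace j with 0%nat by lia.
- destruct (Nat.eq_dec j (S n)) as [->|Hne]; [reflexivity|].
  cbn [bernoulli_upto]. destruct (Nat.leb_spec j n); [apply IH; lia | lia].
Qed.

(** Multiplying by $(m+2)!$ turns the summands into $\binom{m+2}{i}B_i^-$, and the defining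
    recurrence of [bernoulli_upto] is this vanishing sum solved for its last term. *)
Lemma normalised_bernoulli_recurrence (m : nat) :
  sum_f_R0 (fun i => normalised_bernoulli Minus i / INR (fact (m + 2 - i))) (S m)
  = 0.
Proof.
assert (Hsplit : sum_f_R0 (fun i => Binomial.C (m + 2) i * bernoulli_upto i i) (S m)
  = 0).
{ rewrite tech5.
  replace (bernoulli_upto (S m) (S m)) with
    (- / INR (m + 2) *
       sum_f_R0 (fun i => Binomial.C (m + 2) i * bernoulli_upto i i) m).
  (* The coefficient of the last term cancels the factor $-1/(m+2)$ of the definition up to sign. *)
  - assert (HC : Binomial.C (m + 2) (S m) = INR (m + 2)).
    { unfold Binomial.C. replace (m + 2 - S m)%nat with 1%nat by lia.
      replace (m + 2)%nat with (S (S m)) by lia.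
      rewrite (fact_simpl (S m)), mult_INR. simpl (fact 1). simpl (INR 1).
      field. apply INR_fact_neq_0. }
    rewrite HC. field. apply not_0_INR. lia.
  - cbn [bernoulli_upto]. destruct (Nat.leb_spec (S m) m); [lia|].
    f_equal. apply sum_eq. intros i Hi. now rewrite (bernoulli_upto_diag m i). }
apply Rmult_eq_reg_l with (INR (fact (m + 2))); [|apply INR_fact_neq_0].
rewrite Rmult_0_r, <- Hsplit, scal_sum. apply sum_eq. intros i Hi.
unfold normalised_bernoulli, Binomial.C. simpl bernoulli. field.
split; apply INR_fact_neq_0.
Qed.

Lemma normalised_bernoulli_1 (e : pm) :
  normalised_bernoulli e 1 = match e with Plus => 1 / 2 | Minus => - (1 / 2) end.
Proof.
destruct e; unfold normalised_bernoulli; simpl; unfold Binomial.C; simpl; field.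
Qed.

(** * Bernoulli polynomials, scaled as $B_l(x)/l!$ *)

Definition bernoulli_poly (l : nat) (x : R) : R :=
  sum_f_R0 (fun j => x ^ (l - j) / INR (fact (l - j)) * normalised_bernoulli Minus j) l.

Lemma is_derive_sum_f_R0 (f df : nat -> R -> R) (n : nat) (x : R) :
  (forall j, (j <= n)%nat -> is_derive (f j) x (df j x)) ->
  is_derive (fun y => sum_f_R0 (fun j => f j y) n) x (sum_f_R0 (fun j => df j x) n).
Proof.
induction n as [|n IH]; intros H; simpl.
- now apply H.
- apply (@is_derive_plus R_AbsRing R_NormedModule).
  + apply IH. intros j Hj. apply H. lia.
  + now apply H.
Qed.

Lemma is_derive_pow_fact (n : nat) (x : R) :
  is_derive (fun y => y ^ S n / INR (fact (S n))) x (x ^ n / INR (fact n)).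
Proof.
auto_derive; [exact I|].
change (1 * (INR (S n) * x ^ n) * / INR (S n * fact n) = x ^ n / INR (fact n)).
rewrite mult_INR.
field. split; [apply INR_fact_neq_0 | now apply not_0_INR].
Qed.

Lemma is_derive_bernoulli_poly (l : nat) (x : R) :
  is_derive (bernoulli_poly (S l)) x (bernoulli_poly l x).
Proof.
unfold bernoulli_poly.
(* The term of index $l+1$ is constant and is split off; in the others the exponent is a successor,
   as [is_derive_pow_fact] requires. *)
apply is_derive_ext with (fun y =>
  sum_f_R0 (fun j => y ^ S (l - j) / INR (fact (S (l - j)))
                     * normalised_bernoulli Minus j) l
  + normalised_bernoulli Minus (S l)).
- intros y. rewrite tech5, Nat.sub_diag. simpl (y ^ 0). simpl (fact 0). simpl (INR 1).
  f_equal; [|field]. apply sum_eq. intros j Hj.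
  now replace (S l - j)%nat with (S (l - j)) by lia.
- rewrite <- (Rplus_0_r (sum_f_R0 _ l)).
  apply (@is_derive_plus R_AbsRing R_NormedModule).
  + apply (is_derive_sum_f_R0
      (fun j y => y ^ S (l - j) / INR (fact (S (l - j))) * normalised_bernoulli Minus j)
      (fun j y => y ^ (l - j) / INR (fact (l - j)) * normalised_bernoulli Minus j)).
    intros j _.
    apply is_derive_ext with (fun y =>
      scal (normalised_bernoulli Minus j) (y ^ S (l - j) / INR (fact (S (l - j))))).
    * intros y. unfold scal; simpl; unfold mult; simpl. ring.
    * rewrite Rmult_comm. apply is_derive_scal, is_derive_pow_fact.
  + apply (@is_derive_const R_AbsRing R_NormedModule).
Qed.

Lemma bernoulli_poly_0 (l : nat) : bernoulli_poly l 0 = normalised_bernoulli Minus l.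
Proof.
unfold bernoulli_poly. destruct l as [|l].
- simpl. field.
- rewrite tech5, Nat.sub_diag.
  rewrite sum_eq_R0.
  + simpl (0 ^ 0). simpl (fact 0). simpl (INR 1). field.
  + intros j Hj. rewrite pow_i by lia. unfold Rdiv. ring.
Qed.

(** At $x=1$ all terms but the last add up to the recurrence with $m=l$. The index starts at 2
    because the values at 0 and 1 differ in degree 1. *)
Lemma bernoulli_poly_1 (l : nat) :
  bernoulli_poly (S (S l)) 1 = normalised_bernoulli Minus (S (S l)).
Proof.
unfold bernoulli_poly. rewrite tech5, Nat.sub_diag.
replace (sum_f_R0 _ (S l)) with 0.
- simpl (1 ^ 0). simpl (fact 0). simpl (INR 1). field.
- rewrite <- (normalised_bernoulli_recurrence l). apply sum_eq. intros j Hj.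
  rewrite pow1. replace (l + 2)%nat with (S (S l)) by lia.
  field. apply INR_fact_neq_0.
Qed.

Lemma continuous_bernoulli_poly (l : nat) (x : R) : continuous (bernoulli_poly l) x.
Proof.
destruct l as [|l].
- apply continuous_ext with (fun _ => bernoulli_poly 0 0).
  + intros y. unfold bernoulli_poly. simpl. ring.
  + apply continuous_const.
- apply (@ex_derive_continuous R_AbsRing R_NormedModule).
  exists (bernoulli_poly l x). apply is_derive_bernoulli_poly.
Qed.

(** The antiderivative of next higher degree takes equal values at 0 and 1. *)
Lemma is_RInt_bernoulli_poly (l : nat) :
  is_RInt (bernoulli_poly (S l)) 0 1 0.
Proof.
replace 0 with (minus (bernoulli_poly (S (S l)) 1) (bernoulli_poly (S (S l)) 0)) at 2.
- apply (@is_RInt_derive R_CompleteNormedModule).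
  + intros x _. apply is_derive_bernoulli_poly.
  + intros x _. apply continuous_bernoulli_poly.
- rewrite bernoulli_poly_0, bernoulli_poly_1. apply (@minus_eq_zero R_AbelianGroup).
Qed.

(** Induction on the degree: the difference [D] of the two sides has zero derivative by the
    induction hypothesis, hence is constant, and it vanishes at 0 because the polynomial agrees at 0
    and 1. *)
Lemma bernoulli_poly_succ (l : nat) (x : R) :
  bernoulli_poly (S l) (x + 1) - bernoulli_poly (S l) x = x ^ l / INR (fact l).
Proof.
revert x. induction l as [|l IH]; intros x.
- unfold bernoulli_poly, normalised_bernoulli. simpl. field.
- set (D := fun y => bernoulli_poly (S (S l)) (y + 1) - bernoulli_poly (S (S l)) y
                     - y ^ S l / INR (fact (S l))).
  assert (HD : forall y, is_derive D y 0).
  { intros y.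
    replace 0 with (minus (minus (scal 1 (bernoulli_poly (S l) (y + 1)))
                                 (bernoulli_poly (S l) y)) (y ^ l / INR (fact l))).
    - apply (@is_derive_minus R_AbsRing R_NormedModule); [|apply is_derive_pow_fact].
      apply (@is_derive_minus R_AbsRing R_NormedModule);
        [|apply is_derive_bernoulli_poly].
      apply (@is_derive_comp R_AbsRing R_NormedModule).
      + apply is_derive_bernoulli_poly.
      + auto_derive; [exact I | reflexivity].
    - rewrite <- IH. unfold minus, plus, opp, scal; simpl; unfold mult; simpl. ring. }
  assert (H0 : D 0 = 0).
  { unfold D. rewrite Rplus_0_l, bernoulli_poly_0, bernoulli_poly_1, pow_i by lia.
    unfold Rdiv. ring. }
  assert (Hx : D x = D 0).
  { destruct (MVT_gen D 0 x (fun _ => 0)) as [z [_ Hz]].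
    - intros y _. apply HD.
    - intros y _. apply continuity_pt_filterlim.
      apply (@ex_derive_continuous R_AbsRing R_NormedModule).
      exists 0. apply HD.
    - lra. }
  rewrite H0 in Hx. unfold D in Hx. lra.
Qed.

(** * Sawtooth functions as periodic Bernoulli functions *)

Lemma sum_below_S (f : nat -> R) (n : nat) :
  sum_below f (S n) = sum_below f n + f n.
Proof.
unfold sum_below. rewrite seq_S, map_app, fold_right_app. simpl.
rewrite Rplus_0_r. generalize (map f (seq 0 n)) as s.
induction s as [|a s IH]; simpl; [ring|]. rewrite IH. ring.
Qed.

Lemma sum_below_shift (f : nat -> R) (n : nat) :
  sum_below f (S n) = f 0%nat + sum_below (fun k => f (S k)) n.
Proof.
unfold sum_below. simpl. now rewrite <- seq_shift, map_map.
Qed.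

(** The sum is the one that the [Plus] sawtooth subtracts when $[t]=n$, so the subtraction moves the
    argument back into the first period. *)
Lemma bernoulli_poly_telescope (l n : nat) (t : R) :
  bernoulli_poly (S l) t
  = bernoulli_poly (S l) (t - INR n)
    + sum_below (fun k => (t - INR k - 1) ^ l / INR (fact l)) n.
Proof.
induction n as [|n IH].
- unfold sum_below. simpl. now rewrite Rminus_0_r, Rplus_0_r.
- rewrite sum_below_S, <- bernoulli_poly_succ, IH.
  replace (t - INR n - 1 + 1) with (t - INR n) by ring.
  rewrite S_INR. replace (t - (INR n + 1)) with (t - INR n - 1) by ring. ring.
Qed.

Lemma Int_part_between (n : nat) (t : R) :
  INR n < t < INR n + 1 -> Int_part t = Z.of_nat n.
Proof.
intros Ht. symmetry. apply Int_part_spec. rewrite <- INR_IZR_INZ. lra.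
Qed.

Lemma sum_f_R0_delta (a : R) (i n : nat) :
  (i <= n)%nat -> sum_f_R0 (fun j => if (j =? i)%nat then a else 0) n = a.
Proof.
induction n as [|n IH]; intros Hi.
- replace i with 0%nat by lia. reflexivity.
- rewrite tech5. destruct (Nat.eqb_spec (S n) i) as [<-|Hne].
  + rewrite sum_eq_R0; [ring|]. intros j Hj.
    destruct (Nat.eqb_spec j (S n)); [lia | reflexivity].
  + rewrite IH by lia. ring.
Qed.

(* With [B_1^+ = 1/2], the sign change at index 1 in [below] gives back
   [B_1^- = -1/2]; with [B_1^-] it gives [1/2 = B_1^- + 1]. *)
Lemma sum_below_normalised_bernoulli (e : pm) (b : nat -> R) (l : nat) (t : R) :
  (forall j, (j < S (S l))%nat -> b j = normalised_bernoulli e j) ->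
  sum_f_R0 (fun j => t ^ (S (S l) - j) / INR (fact (S (S l) - j))
                     * below b (S (S l)) j) (S (S l))
  = bernoulli_poly (S (S l)) t - normalised_bernoulli Minus (S (S l))
    + match e with Plus => 0 | Minus => t ^ S l / INR (fact (S l)) end.
Proof.
intros Hb. unfold bernoulli_poly.
rewrite (tech5 _ (S l)), (tech5 _ (S l)), !Nat.sub_diag.
assert (Hl : below b (S (S l)) (S (S l)) = 0).
{ unfold below. now rewrite Nat.ltb_irrefl. }
rewrite Hl.
set (a := match e with Plus => 0 | Minus => t ^ S l / INR (fact (S l)) end).
rewrite (sum_eq _ (fun j =>
  t ^ (S (S l) - j) / INR (fact (S (S l) - j)) * normalised_bernoulli Minus j
  + if (j =? 1)%nat then a else 0)).
- rewrite sum_plus, sum_f_R0_delta by lia.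
  simpl (t ^ 0). simpl (fact 0). simpl (INR 1). field.
- intros j Hj. unfold below. destruct (Nat.ltb_spec j (S (S l))); [|lia].
  rewrite Hb by assumption.
  destruct (Nat.eqb_spec j 1) as [->|Hne].
  + replace (S (S l) - 1)%nat with (S l) by lia.
    unfold a. rewrite !normalised_bernoulli_1.
    generalize (t ^ S l / INR (fact (S l))). intros y. destruct e; field.
  + rewrite Rplus_0_r. f_equal.
    destruct e; [|reflexivity]. destruct j as [|[|j]]; [reflexivity | lia | reflexivity].
Qed.

Lemma sawtooth_bernoulli (e : pm) (b : nat -> R) (l n : nat) (t : R) :
  (forall j, (j < S (S l))%nat -> b j = normalised_bernoulli e j) ->
  INR n < t < INR n + 1 ->
  sawtooth e (below b (S (S l))) (S (S l)) t
  = bernoulli_poly (S (S l)) (t - INR n) - normalised_bernoulli Minus (S (S l)).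
Proof.
intros Hb Ht. unfold sawtooth.
rewrite (sum_below_normalised_bernoulli e b l t Hb), (Int_part_between n t Ht).
rewrite (bernoulli_poly_telescope (S l) n t).
destruct e.
- rewrite Nat2Z.id. ring.
- replace (Z.of_nat n + 1)%Z with (Z.of_nat (S n)) by lia.
  (* The term $k=0$ cancels the extra power of $t$ due to the sign change at index 1; the remaining
     terms, reindexed, form the [Plus] sum. *)
  rewrite Nat2Z.id, sum_below_shift. simpl (INR 0). rewrite Rminus_0_r.
  replace (sum_below (fun k => (t - INR (S k)) ^ S l / INR (fact (S l))) n)
    with (sum_below (fun k => (t - INR k - 1) ^ S l / INR (fact (S l))) n).
  + ring.
  + unfold sum_below. f_equal. apply map_ext. intros k. rewrite S_INR.
    now replace (t - (INR k + 1)) with (t - INR k - 1) by ring.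
Qed.

(** * The minimisation problems and the recursive characterisation *)

Lemma unique_minimiser_first (N : nat) (e : pm) (x : R) :
  (1 <= N)%nat ->
  unique (is_minimiser (fun v =>
    RInt (fun t => Rabs (t - integer_part_of e t - v) ^ 2) 0 (INR N))) x
  <-> x = normalised_bernoulli e 1.
Proof.
intros HN.
(* Since $[t+1]=[t]+1$, the function on one period is $y-d$, with mean $\frac12-d$. *)
set (d := match e with Plus => 0 | Minus => 1 end).
apply (unique_minimiser_mean (fun t => t - integer_part_of e t) (fun y => y - d));
  [exact HN | | |].
- intros n t Ht. unfold integer_part_of, d. destruct e.
  + rewrite (Int_part_between n t Ht), <- INR_IZR_INZ. ring.
  + rewrite (Int_part_between (S n) (t + 1)) by (rewrite S_INR; lra).
    rewrite <- INR_IZR_INZ, S_INR. ring.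
- intros y. apply (@ex_derive_continuous R_AbsRing R_NormedModule).
  auto_derive. exact I.
- replace (normalised_bernoulli e 1)
    with (minus (1 ^ 2 / 2 - d * 1) (0 ^ 2 / 2 - d * 0)).
  + apply (@is_RInt_derive R_CompleteNormedModule (fun y => y ^ 2 / 2 - d * y)).
    * intros y _. auto_derive; [exact I | field].
    * intros y _. apply (@ex_derive_continuous R_AbsRing R_NormedModule).
      auto_derive. exact I.
  + rewrite normalised_bernoulli_1. unfold d, minus, plus, opp.
    destruct e; simpl; field.
Qed.

Lemma unique_minimiser_sawtooth (N : nat) (e : pm) (b : nat -> R) (l : nat) (x : R) :
  (1 <= N)%nat -> (2 <= l)%nat ->
  (forall j, (j < l)%nat -> b j = normalised_bernoulli e j) ->
  unique (is_minimiser (fun v =>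
    RInt (fun t => Rabs (sawtooth e (below b l) l t + v) ^ 2) 0 (INR N))) x
  <-> x = normalised_bernoulli e l.
Proof.
intros HN Hl Hb. destruct l as [|[|l]]; [lia | lia |].
set (c := normalised_bernoulli Minus (S (S l))).
replace (normalised_bernoulli e (S (S l))) with c by (now destruct e).
(* As $|s+v|=|-s-v|$, the minimiser is the mean of $-s$. On a period $-s$ is $c$ minus a polynomial
   of mean zero, so this mean is $c$. *)
rewrite <- (unique_minimiser_mean
  (fun t => - sawtooth e (below b (S (S l))) (S (S l)) t)
  (fun y => c - bernoulli_poly (S (S l)) y) c N x HN).
- assert (HQ : forall v,
    RInt (fun t => Rabs (sawtooth e (below b (S (S l))) (S (S l)) t + v) ^ 2) 0 (INR N)
    = RInt (fun t => Rabs (- sawtooth e (below b (S (S l))) (S (S l)) t - v) ^ 2)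
        0 (INR N)).
  { intros v. apply RInt_ext. intros t _. rewrite !pow2_abs.
    generalize (sawtooth e (below b (S (S l))) (S (S l)) t). intros s.
    change ((s + v) ^ 2 = (- s - v) ^ 2 :> R). ring. }
  now apply unique_minimiser_ext.
- intros n t Ht. rewrite (sawtooth_bernoulli e b l n t Hb Ht). unfold c. ring.
- intros y. apply (@continuous_minus R_UniformSpace R_AbsRing R_NormedModule).
  + apply continuous_const.
  + apply continuous_bernoulli_poly.
- assert (Hc : minus (scal (1 - 0) c) 0 = c :> R).
  { unfold minus, plus, opp, scal; simpl; unfold mult; simpl. ring. }
  rewrite <- Hc at 1.
  apply (@is_RInt_minus R_NormedModule).
  + apply (@is_RInt_const R_NormedModule).
  + apply is_RInt_bernoulli_poly.
Qed.

Theorem corollary1p6 (N : nat) (hN : (1 <= N)%nat) (e : pm) (b : nat -> R) :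
  (forall l : nat, b l = normalised_bernoulli e l) <->
  (b 0%nat = 1 /\
   unique (is_minimiser (fun v =>
     RInt (fun t => Rabs (t - integer_part_of e t - v) ^ 2) 0 (INR N)))
     (b 1%nat) /\
   (forall l : nat, (2 <= l)%nat ->
      unique (is_minimiser (fun v =>
        RInt (fun t => Rabs (sawtooth e (below b l) l t + v) ^ 2) 0 (INR N)))
        (b l))).
Proof.
split.
- intros Hb. split; [|split].
  + rewrite Hb. destruct e; unfold normalised_bernoulli; simpl; field.
  + now apply unique_minimiser_first.
  + intros l Hl. now apply unique_minimiser_sawtooth.
- intros [H0 [H1 H2]] l.
  (* Strong induction, since [below b l] involves all earlier terms; once these are known,
     uniqueness of the minimiser fixes [b l]. *)
  induction l as [l IH] using (well_founded_induction lt_wf).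
  destruct l as [|[|l]].
  + rewrite H0. destruct e; unfold normalised_bernoulli; simpl; field.
  + exact (proj1 (unique_minimiser_first N e (b 1%nat) hN) H1).
  + assert (Hl : (2 <= S (S l))%nat) by lia.
    exact (proj1 (unique_minimiser_sawtooth N e b _ _ hN Hl IH) (H2 _ Hl)).
Qed.
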